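(* Let $L\geq 1$ be an integer and let $\mathbf{p}_L=(p_1,\ldots,p_L)$ be fixed, with $p_i\geq 0$ and $\sum_{i=1}^L p_i\leq 1$. Let $G=G(\mathbf{p}_L)$ be the probability distribution on the positive integers that assigns probability $p_d$ to each $d\in\{1,\ldots,L\}$, probability $p_{>L}=1-\sum_{i=1}^L p_i$ to $L+1$, and probability $0$ to every $d\geq L+2$. Then $$\xi_F\geq \xi_G\qquad\text{for all }F\in\mathcal{F}(\mathbf{p}_L).$$
   Context: All degree distributions $F=\{p_d\}_{d\geq 0}$ are probability distributions on the non-negative integers with $p_0=0$, with finite mean, and, for the distributions in the class below, with $p_2\neq 1$. For such an $F$ with $D\sim F$, write $\mu_F=\mathbb{E}[D]=\sum_d d\,p_d$ and $g_F(s)=\sum_{d}p_d s^d$ for $s\in[0,1]$. The down-shifted size-biased version $\tilde F=\{\tilde p_d\}_{d\geq 0}$ of $F$ is $\tilde p_d=(d+1)p_{d+1}/\mu_F$; its probability generating function is $g_F'(s)/\mu_F$. Let $\tilde z_F$ be the extinction probability of a (Galton–Watson) branching process with offspring distribution $\tilde F$, that is, the smallest non-negative solution of $s=g_F'(s)/\mu_F$. The size of the giant component is $$\xi_F=1-g_F(\tilde z_F),$$ which is the asymptotic fraction of vertices in the largest component of the configuration model with i.i.d. degrees distributed as $F$. The quantities $\tilde z_G$ and $\xi_G$ are given by the same formulas with $G$ in place of $F$, using the mean of $G$. $\mathcal{F}(\mathbf{p}_L)$ denotes the set of all probability distributions on the non-negative integers that assign probability $0$ to the integer $0$, have finite mean,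 do not assign probability $1$ to the integer $2$, and whose probabilities of the degrees $1,\ldots,L$ are exactly $p_1,\ldots,p_L$. *)

(* Defs.v *)
From Stdlib Require Import Reals Lra Classical.
From Coquelicot Require Import Coquelicot.
Open Scope R_scope.

Definition is_distribution (p : nat -> R) : Prop :=
  (forall d, 0 <= p d) /\ is_series p 1.

Definition has_finite_mean (p : nat -> R) : Prop :=
  ex_series (fun d => INR d * p d).

Definition mean (p : nat -> R) : R := Series (fun d => INR d * p d).

Definition pgf (p : nat -> R) (s : R) : R := PSeries p s.

(* Down-shifted size-biased version.  Its generating function [pgf (tilde p)]
   is g'(s) / mean p, where g'(1) is the left derivative; the two-sided
   [Derive (pgf p)] is therefore not usable at s = 1. *)
Definition tilde (p : nat -> R) (d : nat) : R :=
  INR (S d) * p (S d) / mean p.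

(* Generating functions live on [0,1].  There s = 1 is always a fixed point,
   so bounding s by 1 does not affect which fixed point is the smallest. *)
Definition pgf_fixpoint (q : nat -> R) (s : R) : Prop :=
  0 <= s <= 1 /\ s = pgf q s.

(* Extinction probability of a branching process with offspring law [q]: the
   smallest fixed point of its generating function.  The infimum is attained,
   see [extinction_prob_smallest]. *)
Definition extinction_prob (q : nat -> R) : R :=
  real (Glb_Rbar (pgf_fixpoint q)).

Definition giant_component_size (p : nat -> R) : R :=
  1 - pgf p (extinction_prob (tilde p)).

(* The vector (p_1, ..., p_L) is the restriction of [pL : nat -> R] to the
   indices 1, ..., L; the other values of [pL] are never used. *)
Definition distribution_class (L : nat) (pL : nat -> R) (F : nat -> R) : Prop :=
  is_distribution F /\ F 0%nat = 0 /\ has_finite_mean F /\ F 2%nat <> 1 /\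
  (forall i, (1 <= i <= L)%nat -> F i = pL i).

Definition minimal_distribution (L : nat) (pL : nat -> R) (d : nat) : R :=
  if (d =? 0)%nat then 0
  else if (d <=? L)%nat then pL d
  else if (d =? L + 1)%nat then 1 - sum_n_m pL 1 L
  else 0.

Lemma pgf_fixpoint_1 (q : nat -> R) :
  is_distribution q -> pgf_fixpoint q 1.
Proof.
intros [_ H]; split; [lra|].
unfold pgf, PSeries; symmetry; apply is_series_unique.
apply is_series_ext with q; [|exact H].
intros n; rewrite pow1, Rmult_1_r; reflexivity.
Qed.

Lemma pgf_continuous (q : nat -> R) (s : R) :
  is_distribution q -> 0 <= s < 1 -> continuity_pt (pgf q) s.
Proof.
intros [q0 Hq] Hs.
apply (PSeries_continuity q s).
apply Rbar_lt_le_trans with (Finite 1).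
- simpl; rewrite Rabs_pos_eq; lra.
- apply (proj1 (Lub_Rbar_correct (CV_disk q))).
  unfold CV_disk; exists 1.
  apply is_series_ext with q; [|exact Hq].
  intros n; rewrite pow1, Rmult_1_r, Rabs_pos_eq; [reflexivity | apply q0].
Qed.

Lemma extinction_prob_smallest (q : nat -> R) :
  is_distribution q ->
  pgf_fixpoint q (extinction_prob q) /\
  (forall s, pgf_fixpoint q s -> extinction_prob q <= s).
Proof.
intros Hq; pose proof (pgf_fixpoint_1 q Hq) as H1.
unfold extinction_prob.
destruct (Glb_Rbar_correct (pgf_fixpoint q)) as [Hlb Hglb].
assert (G0 : Rbar_le 0 (Glb_Rbar (pgf_fixpoint q))).
{ apply Hglb; intros s [[Hs _] _]; exact Hs. }
assert (G1 := Hlb 1 H1).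
destruct (Glb_Rbar (pgf_fixpoint q)) as [z| |]; simpl in G0, G1; try easy.
simpl; split; [|exact Hlb].
destruct (Req_dec z 1) as [->|Hz1]; [exact H1|].
apply NNPP; intros Hnz.
assert (Hne : pgf q z - z <> 0).
{ intros E; apply Hnz; split; lra. }
assert (Hc : continuity_pt (fun s => pgf q s - s) z).
{ apply continuity_pt_minus; [apply pgf_continuous; [exact Hq|lra]|].
  apply derivable_continuous_pt, derivable_pt_id. }
destruct (Hc (Rabs (pgf q z - z)) (Rabs_pos_lt _ Hne)) as [e [He Hd]].
assert (Hle : Rbar_le (z + e) z).
{ apply Hglb; intros s Hs; simpl.
  assert (Hzs : z <= s) by exact (Hlb s Hs).
  destruct (Rle_lt_dec (z + e) s) as [|Hlt]; [assumption|exfalso].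
  assert (Hsz : s <> z) by (intros ->; contradiction).
  assert (Hb := Hd s); simpl in Hb; unfold R_dist in Hb.
  destruct Hs as [_ Es].
  assert (Hlt' : Rabs (pgf q s - s - (pgf q z - z)) < Rabs (pgf q z - z)).
  { apply Hb; split; [split; [exact I|congruence]|].
    rewrite Rabs_pos_eq; lra. }
  replace (pgf q s - s - (pgf q z - z)) with (- (pgf q z - z)) in Hlt' by lra.
  rewrite Rabs_Ropp in Hlt'; lra. }
simpl in Hle; lra.
Qed.

(* Main.v *)
Require Import Defs.
From Stdlib Require Import Reals.
From Coquelicot Require Import Coquelicot.
From Stdlib Require Import Lra Lia.
Open Scope R_scope.

(** For a degree distribution [p] and [0 <= s <= 1],
      [mean p * (s - pgf (tilde p) s) = sum_d p d * (d * (s - s ^ (d - 1)))],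
    so the fixed points of the offspring generating function can be studied
    through an expectation that is linear in [p] ([is_series_tilde_gap]).  The
    law [G = minimal_distribution L pL] arises from [F] by moving all mass
    above [L] down to [L + 1].  Hence [G] has the smaller expectation for every
    [h] with [h (L + 1) <= h d] for all [d >= L + 1] ([expectation_le]).

    Both [h d = d * (s - s ^ (d - 1))] and [h d = - s ^ d] are nondecreasing on
    [d >= 2], and [L + 1 >= 2].  At the extinction probability [z] of
    [tilde G] the first choice gives [pgf (tilde F) z <= z], so by the
    intermediate value theorem the smallest fixed point of [pgf (tilde F)] is
    at most [z] ([extinction_prob_le]).  The second choice gives
    [pgf F z <= pgf G z].  As [pgf F] is nondecreasing on [0, 1],
    [pgf F (extinction_prob (tilde F)) <= pgf F z <= pgf G z]. *)

(** * Powers and series *)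

Lemma pow_unit_interval (s : R) (d : nat) : 0 <= s <= 1 -> 0 <= s ^ d <= 1.
Proof.
intros Hs; split; [apply pow_le; lra|].
rewrite <- (pow1 d); apply pow_incr; lra.
Qed.

Lemma pow_decr (s : R) (m n : nat) :
  0 <= s <= 1 -> (m <= n)%nat -> s ^ n <= s ^ m.
Proof.
intros Hs Hmn; replace n with (m + (n - m))%nat by lia.
rewrite pow_add, <- (Rmult_1_r (s ^ m)) at 1.
destruct (pow_unit_interval s m Hs), (pow_unit_interval s (n - m) Hs).
nra.
Qed.

Lemma is_series_le (a b : nat -> R) (la lb : R) :
  (forall n, a n <= b n) -> is_series a la -> is_series b lb -> la <= lb.
Proof.
intros Hab Ha Hb.
assert (Hle : Rbar_le la lb); [|exact Hle].
apply (is_lim_seq_le (sum_n a) (sum_n b)); [|exact Ha|exact Hb].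
intros n; apply sum_n_m_le, Hab.
Qed.

Lemma is_series_finite_support (a : nat -> R) (N : nat) :
  (forall n, (N < n)%nat -> a n = 0) -> is_series a (sum_n a N).
Proof.
intros Ha.
assert (H : is_lim_seq (sum_n a) (sum_n a N)); [|exact H].
apply is_lim_seq_ext_loc with (fun _ => sum_n a N); [|apply is_lim_seq_const].
exists N; intros n Hn; induction Hn as [|n Hn IH]; [reflexivity|].
rewrite sum_Sn, <- IH, Ha by lia.
symmetry; apply Rplus_0_r.
Qed.

(** * Generating functions of degree distributions *)

Lemma is_series_pgf (q : nat -> R) (s : R) :
  is_distribution q -> 0 <= s <= 1 ->
  is_series (fun d => q d * s ^ d) (pgf q s).
Proof.
intros [q0 Hq] Hs; unfold pgf, PSeries; apply Series_correct.
apply (ex_series_le (fun d => q d * s ^ d) q); [|exists 1; exact Hq].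
intros d; destruct (pow_unit_interval s d Hs).
change (Rabs (q d * s ^ d) <= q d).
rewrite Rabs_pos_eq; specialize (q0 d); nra.
Qed.

Lemma pgf_incr (q : nat -> R) (s t : R) :
  is_distribution q -> 0 <= s <= t -> t <= 1 -> pgf q s <= pgf q t.
Proof.
intros Hq Hst Ht.
apply (is_series_le (fun d => q d * s ^ d) (fun d => q d * t ^ d));
  [|apply is_series_pgf; [exact Hq|lra]..].
intros d; apply Rmult_le_compat_l; [apply Hq|apply pow_incr; lra].
Qed.

Lemma pgf_at_0 (q : nat -> R) : pgf q 0 = q 0%nat.
Proof. apply PSeries_0. Qed.

(** Any point where the generating function is below the diagonal lies above
    its smallest fixed point. *)
Lemma extinction_prob_le (q : nat -> R) (s : R) :
  is_distribution q -> 0 <= s <= 1 -> pgf q s <= s -> extinction_prob q <= s.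
Proof.
intros Hq Hs Hle.
destruct (extinction_prob_smallest q Hq) as [_ Hmin].
destruct (Req_dec s 1) as [->|Hs1]; [apply Hmin, pgf_fixpoint_1, Hq|].
destruct (Req_dec (pgf q s) s) as [E|Hne]; [apply Hmin; split; lra|].
destruct (Req_dec (pgf q 0) 0) as [E|Hne0].
{ apply Rle_trans with 0; [apply Hmin; split; lra|lra]. }
assert (H0 : 0 < pgf q 0).
{ rewrite pgf_at_0 in *; destruct (proj1 Hq 0%nat); lra. }
destruct (Req_dec s 0) as [->|Hs0]; [lra|].
destruct (Ranalysis5.IVT_interv (fun x => x - pgf q x) 0 s) as [z [Hz Ez]];
  try lra.
- intros a Ha; apply continuity_pt_minus.
  + apply derivable_continuous_pt, derivable_pt_id.
  + apply pgf_continuous; [exact Hq|lra].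
- apply Rle_trans with z; [apply Hmin; split|]; lra.
Qed.

Lemma is_series_mean (p : nat -> R) :
  has_finite_mean p -> is_series (fun d => INR d * p d) (mean p).
Proof. apply Series_correct. Qed.

Lemma mean_pos (p : nat -> R) :
  is_distribution p -> p 0%nat = 0 -> has_finite_mean p -> 0 < mean p.
Proof.
intros [Hp0 Hp] H0 Hm; apply Rlt_le_trans with 1; [lra|].
apply (is_series_le p (fun d => INR d * p d));
  [|exact Hp|apply is_series_mean, Hm].
intros [|d]; [rewrite H0; simpl; lra|].
rewrite S_INR; pose proof (pos_INR d); specialize (Hp0 (S d)); nra.
Qed.

Lemma tilde_distribution (p : nat -> R) :
  is_distribution p -> p 0%nat = 0 -> has_finite_mean p ->
  is_distribution (tilde p).
Proof.
intros Hp H0 Hm; pose proof (mean_pos p Hp H0 Hm) as Hmu; split.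
- intros d; unfold tilde; apply Rdiv_le_0_compat; [|exact Hmu].
  apply Rmult_le_pos; [apply pos_INR|apply Hp].
- replace 1 with (mean p * / mean p) by (field; lra).
  apply (is_series_scal_r (/ mean p) (fun d => INR (S d) * p (S d))).
  apply (is_series_incr_1 (fun d => INR d * p d)).
  replace (plus (mean p) _) with (mean p); [apply is_series_mean, Hm|].
  unfold plus; simpl; ring.
Qed.

(** The distance of the generating function of [tilde p] from the diagonal, as
    an expectation under [p].  The truncated predecessor of [d = 0] does not
    matter, because that term has the factor [INR 0]. *)
Lemma is_series_tilde_gap (p : nat -> R) (s : R) :
  is_distribution p -> p 0%nat = 0 -> has_finite_mean p -> 0 <= s <= 1 ->
  is_series (fun d => p d * (INR d * (s - s ^ pred d)))
    (mean p * (s - pgf (tilde p) s)).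
Proof.
intros Hp H0 Hm Hs; pose proof (mean_pos p Hp H0 Hm) as Hmu.
assert (HB : is_series (fun d => INR d * p d * s ^ pred d)
               (mean p * pgf (tilde p) s)).
{ apply (is_series_decr_1 (fun d => INR d * p d * s ^ pred d)).
  replace (plus _ _) with (mean p * pgf (tilde p) s)
    by (unfold plus, opp; simpl; ring).
  apply is_series_ext with (fun d => mean p * (tilde p d * s ^ d)).
  - intros d; unfold tilde.
    match goal with |- ?x = ?y => change (x = y :> R) end.
    change (pred (S d)) with d; field; lra.
  - apply (is_series_scal_l (mean p) (fun d => tilde p d * s ^ d)).
    apply is_series_pgf; [|exact Hs].
    apply tilde_distribution; assumption. }
pose proof (is_series_scal_r s _ _ (is_series_mean p Hm)) as HA.
replace (mean p * (s - pgf (tilde p) s))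
  with (minus (mean p * s) (mean p * pgf (tilde p) s))
  by (unfold minus, plus, opp; simpl; ring).
refine (is_series_ext _ _ _ _ (is_series_minus _ _ _ _ HA HB)).
intros d; unfold minus, plus, opp; simpl; ring.
Qed.

(** * The minimal distribution *)

Lemma minimal_0 (L : nat) (pL : nat -> R) : minimal_distribution L pL 0 = 0.
Proof. reflexivity. Qed.

Lemma minimal_low (L : nat) (pL : nat -> R) (d : nat) :
  (1 <= d <= L)%nat -> minimal_distribution L pL d = pL d.
Proof.
intros Hd; unfold minimal_distribution.
destruct (Nat.eqb_spec d 0); [lia|].
destruct (Nat.leb_spec d L); [reflexivity|lia].
Qed.

Lemma minimal_top (L : nat) (pL : nat -> R) :
  minimal_distribution L pL (S L) = 1 - sum_n_m pL 1 L.
Proof.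
unfold minimal_distribution.
destruct (Nat.eqb_spec (S L) 0); [lia|].
destruct (Nat.leb_spec (S L) L); [lia|].
destruct (Nat.eqb_spec (S L) (L + 1)); [reflexivity|lia].
Qed.

Lemma minimal_high (L : nat) (pL : nat -> R) (d : nat) :
  (S L < d)%nat -> minimal_distribution L pL d = 0.
Proof.
intros Hd; unfold minimal_distribution.
destruct (Nat.eqb_spec d 0); [lia|].
destruct (Nat.leb_spec d L); [lia|].
destruct (Nat.eqb_spec d (L + 1)); [lia|reflexivity].
Qed.

Lemma minimal_is_distribution (L : nat) (pL : nat -> R) :
  (forall i, (1 <= i <= L)%nat -> 0 <= pL i) -> sum_n_m pL 1 L <= 1 ->
  is_distribution (minimal_distribution L pL).
Proof.
intros Hpos Hsum; split.
- intros d; destruct d as [|d]; [rewrite minimal_0; lra|].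
  destruct (Nat.le_gt_cases (S d) L) as [Hd|Hd].
  + rewrite minimal_low by lia; apply Hpos; lia.
  + destruct (Nat.eq_dec d L) as [->|Hne].
    * rewrite minimal_top; lra.
    * rewrite minimal_high by lia; lra.
- replace 1 with (sum_n (minimal_distribution L pL) (S L)).
  + apply is_series_finite_support; intros d; apply minimal_high.
  + rewrite sum_Sn, minimal_top; unfold sum_n.
    rewrite sum_Sn_m by lia.
    rewrite (sum_n_m_ext_loc _ pL 1 L)
      by (intros d Hd; apply minimal_low; lia).
    rewrite minimal_0; unfold plus; simpl; ring.
Qed.

Lemma minimal_has_finite_mean (L : nat) (pL : nat -> R) :
  has_finite_mean (minimal_distribution L pL).
Proof.
eexists; apply (is_series_finite_support _ (S L)).
intros d Hd; rewrite minimal_high by lia; ring.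
Qed.

(** Moving the mass above [L] down to [L + 1] decreases the expectation of
    every function that is smallest at [L + 1] among the arguments above [L].
    Subtracting the constant [h (S L)], which changes both expectations
    equally, turns this into a termwise inequality. *)
Lemma expectation_le (L : nat) (pL F h : nat -> R) (a b : R) :
  is_distribution F -> F 0%nat = 0 ->
  (forall i, (1 <= i <= L)%nat -> F i = pL i) ->
  is_distribution (minimal_distribution L pL) ->
  (forall d, (S L <= d)%nat -> h (S L) <= h d) ->
  is_series (fun d => minimal_distribution L pL d * h d) a ->
  is_series (fun d => F d * h d) b ->
  a <= b.
Proof.
intros [F0 HF] FO Flow [_ HG] Hh Ha Hb.
set (G := minimal_distribution L pL) in *; set (c := h (S L)) in *.
assert (Hshift : forall p l, is_series p 1 ->
    is_series (fun d => p d * h d) l ->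
    is_series (fun d => p d * (h d - c)) (l - c)).
{ intros p l Hp Hl.
  pose proof (is_series_minus _ _ _ _ Hl (is_series_scal_r c _ _ Hp)) as H.
  replace (l - c) with (minus l (1 * c))
    by (unfold minus, plus, opp; simpl; ring).
  refine (is_series_ext _ _ _ _ H).
  intros d; unfold minus, plus, opp; simpl; ring. }
enough (a - c <= b - c) by lra.
apply (is_series_le _ _ _ _) with (2 := Hshift G a HG Ha)
  (3 := Hshift F b HF Hb).
intros d; destruct d as [|d]; [unfold G; rewrite minimal_0, FO; lra|].
destruct (Nat.le_gt_cases (S d) L) as [Hd|Hd].
- unfold G; rewrite minimal_low, Flow by lia; lra.
- destruct (Nat.eq_dec d L) as [->|Hne]; [unfold c; lra|].
  unfold G; rewrite minimal_high by lia.
  specialize (F0 (S d)); specialize (Hh (S d) ltac:(lia)); nra.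
Qed.

(** * Comparison of giant components *)

Lemma size_biased_gap_incr (s : R) (m d : nat) :
  0 <= s <= 1 -> (2 <= m <= d)%nat ->
  INR m * (s - s ^ pred m) <= INR d * (s - s ^ pred d).
Proof.
intros Hs Hmd.
apply Rmult_le_compat.
- apply pos_INR.
- pose proof (pow_decr s 1 (pred m) Hs ltac:(lia)) as H.
  rewrite pow_1 in H; lra.
- apply le_INR; lia.
- pose proof (pow_decr s (pred m) (pred d) Hs ltac:(lia)); lra.
Qed.

Theorem proposition1p1 (L : nat) (pL : nat -> R)
  (hL : (1 <= L)%nat)
  (hpos : forall i, (1 <= i <= L)%nat -> 0 <= pL i)
  (hsum : sum_n_m pL 1 L <= 1) :
  forall F : nat -> R, distribution_class L pL F ->
    giant_component_size F >=
    giant_component_size (minimal_distribution L pL).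
Proof.
intros F (HF & F0 & Fm & _ & Flow).
pose proof (minimal_is_distribution L pL hpos hsum) as HG.
pose proof (minimal_has_finite_mean L pL) as Gm.
pose proof (minimal_0 L pL) as G0.
set (G := minimal_distribution L pL) in *.
pose proof (tilde_distribution F HF F0 Fm) as HtF.
pose proof (tilde_distribution G HG G0 Gm) as HtG.
unfold giant_component_size.
destruct (extinction_prob_smallest (tilde G) HtG) as [[Hz Ez] _].
destruct (extinction_prob_smallest (tilde F) HtF) as [[Hw _] _].
set (z := extinction_prob (tilde G)) in *.
assert (Hgap : mean G * (z - pgf (tilde G) z)
               <= mean F * (z - pgf (tilde F) z)).
{ apply (expectation_le L pL F (fun d => INR d * (z - z ^ pred d)));
    [exact HF|exact F0|exact Flow|exact HG| | |].
  - intros d Hd; apply size_biased_gap_incr; [exact Hz|lia].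
  - apply is_series_tilde_gap; assumption.
  - apply is_series_tilde_gap; assumption. }
assert (Hwz : extinction_prob (tilde F) <= z).
{ apply extinction_prob_le; [exact HtF|exact Hz|].
  pose proof (mean_pos F HF F0 Fm); rewrite <- Ez in Hgap; nra. }
assert (Hpgf : - pgf G z <= - pgf F z).
{ assert (Hopp : forall p, is_distribution p ->
      is_series (fun d => p d * - z ^ d) (- pgf p z)).
  { intros p Hp.
    refine (is_series_ext _ _ _ _
      (is_series_opp _ _ (is_series_pgf p z Hp Hz))).
    intros d; unfold opp; simpl; ring. }
  apply (expectation_le L pL F (fun d => - z ^ d));
    [exact HF|exact F0|exact Flow|exact HG| |apply Hopp, HG|apply Hopp, HF].
  intros d Hd; apply Ropp_le_contravar, pow_decr; [exact Hz|exact Hd]. }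
pose proof (pgf_incr F _ _ HF (conj (proj1 Hw) Hwz) (proj2 Hz)).
lra.
Qed.
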